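(* Let $\{\mathcal{A},G,\sigma,\alpha\}$ be a $G$-crossed system with $G\neq\{e\}$, where $\mathcal{A}$ is a commutative ring, $G$ is an abelian group and $\alpha$ is symmetric, i.e. $\alpha(x,y)=\alpha(y,x)$ for all $(x,y)\in G\times G$. Then $\mathrm{Comm}(\tilde{\mathcal{A}})$ is commutative.
   Context: A $G$-crossed system is a quadruple $\{\mathcal{A},G,\sigma,\alpha\}$ consisting of a unital associative ring $\mathcal{A}$, a group $G$ with unit $e$, a map $\sigma:G\to\mathrm{Aut}(\mathcal{A})$, $x\mapsto\sigma_x$, into the ring automorphisms of $\mathcal{A}$, and a map $\alpha:G\times G\to U(\mathcal{A})$ into the group of invertible elements of $\mathcal{A}$, such that for all $x,y,z\in G$, $a\in\mathcal{A}$: (i) $\sigma_x(\sigma_y(a))=\alpha(x,y)\,\sigma_{xy}(a)\,\alpha(x,y)^{-1}$; (ii) $\alpha(x,y)\,\alpha(xy,z)=\sigma_x(\alpha(y,z))\,\alpha(x,yz)$; (iii) $\alpha(x,e)=\alpha(e,x)=1_{\mathcal{A}}$. The crossed product $\mathcal{A}\rtimes_\alpha^\sigma G$ is the free left $\mathcal{A}$-module with basis $\{\overline{g}: g\in G\}$ (a copy of $G$), made into an associative unital ring by the biadditive multiplication determined by $(a_1\overline{x})(a_2\overline{y})=a_1\sigma_x(a_2)\,\alpha(x,y)\,\overline{xy}$. Its elements are formal sums $\sum_{g\in G}a_g\overline{g}$ with $a_g\in\mathcal{A}$, all but finitely many zero. $\tilde{\mathcal{A}}=\{a\overline{e}\mid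 a\in\mathcal{A}\}$ is the embedded copy of $\mathcal{A}$, and $\mathrm{Comm}(\tilde{\mathcal{A}})=\{b\in\mathcal{A}\rtimes_\alpha^\sigma G\mid ab=ba\ \forall a\in\tilde{\mathcal{A}}\}$. *)

(* Defs.v *)
From HB Require Import structures.
From mathcomp Require Import all_boot all_algebra.
From mathcomp Require Import finmap.
From mathcomp Require Import monalg.

Set Implicit Arguments.
Unset Strict Implicit.
Unset Printing Implicit Defensive.

Import GRing.Theory.
Local Open Scope ring_scope.

Record ring_aut (A : pzRingType) := RingAut {
  aut_fun :> {rmorphism A -> A};
  aut_bij : bijective aut_fun
}.

(* The library's units (unitRingType) require 1 != 0 and decidable
   invertibility; this record makes sense in any unital ring. *)
Record ring_unit (A : pzRingType) := RingUnit {
  uval : A;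
  uinv : A;
  uvalK : uval * uinv = 1;
  uinvK : uinv * uval = 1
}.

Record crossed_system (A : pzRingType) (G : groupType) := CrossedSystem {
  sigma : G -> ring_aut A;
  alpha : G -> G -> ring_unit A;
  sigma_comp : forall (x y : G) (a : A),
    sigma x (sigma y a)
      = uval (alpha x y) * sigma (x * y)%g a * uinv (alpha x y);
  alpha_cocycle : forall x y z : G,
    uval (alpha x y) * uval (alpha (x * y)%g z)
      = sigma x (uval (alpha y z)) * uval (alpha x (y * z)%g);
  alpha_g1 : forall x : G, uval (alpha x 1%g) = 1;
  alpha_1g : forall x : G, uval (alpha 1%g x) = 1
}.

(* The carrier is the type of finitely supported functions G -> A;
   << a *g x >> is the formal term a xbar, and u@_x is the coefficient
   of xbar in u. *)
Definition crossed_product (A : pzRingType) (G : groupType)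
  (S : crossed_system A G) : predArgType := {malg A[G]}.

HB.instance Definition _ (A : pzRingType) (G : groupType)
  (S : crossed_system A G) := GRing.Zmodule.on (crossed_product S).

Section CrossedProduct.
Variables (A : pzRingType) (G : groupType) (S : crossed_system A G).
Local Notation CP := (crossed_product S).
Local Notation sigma := (sigma S).
Local Notation alpha x y := (uval (alpha S x y)).
Implicit Types (a b : A) (x y z : G) (u v w : CP).

Definition cp_term a x : CP := << a *g x >>.

Definition cp_one : CP := cp_term 1 1%g.

Definition cp_mul u v : CP :=
  \sum_(x <- msupp u) \sum_(y <- msupp v)
     cp_term (u@_x * sigma x v@_y * alpha x y) (x * y)%g.

Definition cp_scale a u : CP := \sum_(x <- msupp u) cp_term (a * u@_x) x.

Lemma cp_termD a b x : cp_term (a + b) x = cp_term a x + cp_term b x.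
Proof. exact: monalgUD. Qed.

Lemma cp_term0 x : cp_term 0 x = 0.
Proof. exact: monalgU0. Qed.

Lemma cp_ind (P : CP -> Prop) :
  P 0 -> (forall u v, P u -> P v -> P (u + v)) ->
  (forall a x, P (cp_term a x)) -> forall u, P u.
Proof.
move=> P0 PD PU u; rewrite (monalgE u).
by elim/big_ind: _ => // x _; exact: PU.
Qed.

Lemma sum_supp (F : G -> A -> CP) (u : CP) (d : {fset G}) :
    (forall x, F x 0 = 0) -> (msupp u `<=` d)%fset ->
  \sum_(x <- msupp u) F x u@_x = \sum_(x <- d) F x u@_x.
Proof.
move=> F0 le_ud; apply: (big_fset_incl _ le_ud) => x _ xNu.
by rewrite mcoeff_outdom.
Qed.

Lemma sum_suppD (F : G -> A -> CP) u v :
    (forall x, F x 0 = 0) ->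
    (forall x, {morph F x : a b / a + b}) ->
  \sum_(x <- msupp (u + v)) F x (u + v)@_x
    = \sum_(x <- msupp u) F x u@_x + \sum_(x <- msupp v) F x v@_x.
Proof.
move=> F0 FD; pose d := (msupp u `|` msupp v)%fset.
rewrite (sum_supp (d := d) F0 (msuppD_le u v)).
rewrite (sum_supp (d := d) F0 (fsubsetUl _ _)).
rewrite (sum_supp (d := d) F0 (fsubsetUr _ _)).
rewrite -big_split /=; apply: eq_bigr => x _.
by rewrite (mcoeffD x u v) FD.
Qed.

Lemma sum_suppU (F : G -> A -> CP) a x :
  (forall y, F y 0 = 0) ->
  \sum_(y <- msupp (cp_term a x)) F y (cp_term a x)@_y = F x a.
Proof.
move=> F0; rewrite (sum_supp (d := [fset x]%fset) F0 msuppU_le).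
by rewrite big_seq_fset1 mcoeffUU.
Qed.

Let F1 v x a : CP :=
  \sum_(y <- msupp v) cp_term (a * sigma x v@_y * alpha x y) (x * y)%g.
Let F2 a x y b : CP := cp_term (a * sigma x b * alpha x y) (x * y)%g.

Let F1_0 v x : F1 v x 0 = 0.
Proof. by rewrite /F1 big1 // => y _; rewrite !mul0r cp_term0. Qed.
Let F1_D v x : {morph F1 v x : a b / a + b}.
Proof.
move=> a b; rewrite /F1 -big_split; apply: eq_bigr => y _ /=.
by rewrite !mulrDl cp_termD.
Qed.
Let F2_0 a x y : F2 a x y 0 = 0.
Proof. by rewrite /F2 rmorph0 mulr0 mul0r cp_term0. Qed.
Let F2_D a x y : {morph F2 a x y : b c / b + c}.
Proof. by move=> b c; rewrite /F2 rmorphD mulrDr mulrDl cp_termD. Qed.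

Lemma cp_mulUg a x v : cp_mul (cp_term a x) v = F1 v x a.
Proof. exact: (sum_suppU _ _ (F1_0 v)). Qed.

Lemma cp_mulUU a b x y :
  cp_mul (cp_term a x) (cp_term b y)
    = cp_term (a * sigma x b * alpha x y) (x * y)%g.
Proof. by rewrite cp_mulUg; exact: (sum_suppU _ _ (F2_0 a x)). Qed.

Lemma cp_mulDl : left_distributive cp_mul +%R.
Proof. by move=> u v w; exact: (sum_suppD _ _ (F1_0 w) (F1_D w)). Qed.

Lemma cp_mulDr : right_distributive cp_mul +%R.
Proof.
move=> u v w; rewrite /cp_mul -big_split; apply: eq_bigr => x _.
exact: (sum_suppD _ _ (F2_0 u@_x x) (F2_D u@_x x)).
Qed.

Lemma cp_mul0g : left_zero 0 cp_mul.
Proof. by move=> u; rewrite /cp_mul (msupp0 : msupp (0 : CP) = _) big_seq_fset0. Qed.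

Lemma cp_mulg0 : right_zero 0 cp_mul.
Proof.
by move=> u; rewrite /cp_mul big1 // => x _;
  rewrite (msupp0 : msupp (0 : CP) = _) big_seq_fset0.
Qed.

Lemma sigma1 a : sigma 1%g a = a.
Proof.
apply: (bij_inj (aut_bij (sigma 1%g))); rewrite sigma_comp mulg1.
have := uvalK (Defs.alpha S 1%g 1%g); rewrite alpha_g1 !mul1r => ->.
by rewrite mulr1.
Qed.

Lemma cp_mul1g : left_id cp_one cp_mul.
Proof.
elim/cp_ind => [|u v IHu IHv|a x]; first by rewrite cp_mulg0.
  by rewrite cp_mulDr IHu IHv.
by rewrite cp_mulUU sigma1 alpha_1g mul1r mulr1 mul1g.
Qed.

Lemma cp_mulg1 : right_id cp_one cp_mul.
Proof.
elim/cp_ind => [|u v IHu IHv|a x]; first by rewrite cp_mul0g.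
  by rewrite cp_mulDl IHu IHv.
by rewrite cp_mulUU rmorph1 alpha_g1 !mulr1 mulg1.
Qed.

Lemma cp_mulA : associative cp_mul.
Proof.
move=> u v w; elim/cp_ind: u => [|u1 u2 IH1 IH2|a x].
- by rewrite !cp_mul0g.
- by rewrite !cp_mulDl IH1 IH2.
elim/cp_ind: v => [|v1 v2 IH1 IH2|b y].
- by rewrite !(cp_mul0g, cp_mulg0).
- by rewrite !(cp_mulDl, cp_mulDr) IH1 IH2.
elim/cp_ind: w => [|w1 w2 IH1 IH2|c z].
- by rewrite !cp_mulg0.
- by rewrite !cp_mulDr IH1 IH2.
rewrite !cp_mulUU !rmorphM mulgA; congr cp_term.
rewrite sigma_comp -!mulrA; do 2! congr (_ * _).
by rewrite -alpha_cocycle (mulrA (uinv _)) uinvK mul1r.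
Qed.

HB.instance Definition _ := GRing.Zmodule_isPzRing.Build CP
  cp_mulA cp_mul1g cp_mulg1 cp_mulDl cp_mulDr.

Lemma cp_scaleE a u x : (cp_scale a u)@_x = a * u@_x.
Proof.
rewrite /cp_scale raddf_sum /=; have [xu|xNu] := msuppP u x.
  rewrite (big_fsetD1 x) //= mcoeffUU big1_fset ?addr0 // => y.
  by rewrite in_fsetD1 mcoeffU; case: eqP.
rewrite mulr0 big1_fset // => y yu _; rewrite mcoeffU.
by case: eqP xNu => // <-; rewrite yu.
Qed.

Lemma cp_scaleA a b u : cp_scale a (cp_scale b u) = cp_scale (a * b) u.
Proof. by apply/malgP => x; rewrite !cp_scaleE mulrA. Qed.

Lemma cp_scale1 : left_id 1 cp_scale.
Proof. by move=> u; apply/malgP => x; rewrite cp_scaleE mul1r. Qed.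

Lemma cp_scaleDr : right_distributive cp_scale +%R.
Proof.
move=> a u v; apply/malgP => x; rewrite (mcoeffD x (cp_scale a u)).
by rewrite !cp_scaleE (mcoeffD x u v) mulrDr.
Qed.

Lemma cp_scaleDl u : {morph cp_scale^~ u : a b / a + b}.
Proof.
move=> a b; apply/malgP => x; rewrite (mcoeffD x (cp_scale a u)).
by rewrite !cp_scaleE mulrDl.
Qed.

HB.instance Definition _ := GRing.Zmodule_isLmodule.Build A CP
  cp_scaleA cp_scale1 cp_scaleDr cp_scaleDl.

Definition Atilde (u : CP) : Prop := exists a : A, u = cp_term a 1%g.

End CrossedProduct.

Arguments Atilde {A G} S u.

Definition Comm (R : pzRingType) (X : R -> Prop) (b : R) : Prop :=
  forall a : R, X a -> a * b = b * a.

Definition commutative_subset (R : pzRingType) (X : R -> Prop) : Prop :=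
  forall b c : R, X b -> X c -> b * c = c * b.

(* Main.v *)
Require Import Defs.
From mathcomp Require Import all_boot all_algebra.
From mathcomp Require Import finmap monalg.

(** An element [b] commutes with the copy of [A] exactly when each of its
    coefficients absorbs the twist: comparing coefficients in
    [a b = b a] gives [b_x * sigma_x a = a * b_x].  Hence in a product [b c]
    of two such elements the automorphisms disappear, and over a commutative
    [A] it reads [\sum_x \sum_y b_x c_y alpha(x, y) (x y)], as in a twisted
    group ring with trivial action.  When [A] and [G] are commutative and
    [alpha] is symmetric, this expression is symmetric in [b] and [c]. *)

Set Implicit Arguments.
Unset Strict Implicit.
Unset Printing Implicit Defensive.

Import GRing.Theory.
Local Open Scope ring_scope.

Section Coefficients.
Variables (A : pzRingType) (G : groupType) (S : crossed_system A G).
Implicit Types (a : A) (x : G) (u : crossed_product S).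

Lemma mcoeff_sum_cp_term (f : G -> A) u x :
    (u@_x = 0 -> f x = 0) ->
  (\sum_(y <- msupp u) cp_term S (f y) y : {malg A[G]})@_x = f x.
Proof.
move=> f0; rewrite raddf_sum /=; have [xu|xNu] := msuppP u x.
  rewrite (big_fsetD1 x) //= mcoeffUU big1_fset ?addr0 // => y.
  by rewrite in_fsetD1 mcoeffU; case: eqP.
rewrite (f0 (mcoeff_outdom xNu)) big1_fset // => y yu _; rewrite mcoeffU.
by case: eqP xNu => // <-; rewrite yu.
Qed.

Lemma mcoeff_mul_Atilde a u x : (cp_term S a 1%g * u)@_x = a * u@_x.
Proof.
rewrite [_ * u]cp_mulUg.
under eq_bigr => y _ do rewrite sigma1 alpha_1g mulr1 mul1g.
by rewrite mcoeff_sum_cp_term // => ->; rewrite mulr0.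
Qed.

Lemma mul_AtildeE a u :
  u * cp_term S a 1%g
    = \sum_(x <- msupp u) cp_term S (u@_x * sigma S x a) x.
Proof.
rewrite [LHS]/(cp_mul u _) /cp_mul; apply: eq_bigr => x _.
(* The support of [cp_term a 1] is empty when [a = 0], so the inner sum
   cannot simply be read as a sum over one point. *)
rewrite (sum_suppU (F := fun y b =>
  cp_term S (u@_x * sigma S x b * uval (alpha S x y)) (x * y)%g)).
  by rewrite alpha_g1 mulr1 mulg1.
by move=> y; rewrite rmorph0 mulr0 mul0r cp_term0.
Qed.

Lemma mcoeff_mul_Atilder a u x :
  (u * cp_term S a 1%g)@_x = u@_x * sigma S x a.
Proof. by rewrite mul_AtildeE mcoeff_sum_cp_term // => ->; rewrite mul0r. Qed.

(** The coefficientwise form of membership in the commutant: it is what lets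
    a coefficient [u_x] swallow the automorphism [sigma_x] to its right. *)
Lemma Comm_Atilde_coeff u a x :
  Comm (Atilde S) u -> u@_x * sigma S x a = a * u@_x.
Proof.
move=> uC; rewrite -mcoeff_mul_Atilder -mcoeff_mul_Atilde.
by rewrite uC //; exists a.
Qed.

End Coefficients.

Theorem proposition4p11 (A : comPzRingType) (G : groupType)
    (S : crossed_system A G)
    (ntG : exists x : G, x <> 1%g)
    (abelG : forall x y : G, (x * y)%g = (y * x)%g)
    (alpha_sym : forall x y : G, uval (alpha S x y) = uval (alpha S y x)) :
  commutative_subset (Comm (Atilde S)).
Proof.
move=> b c bC cC.
rewrite [LHS]/(cp_mul b c) [RHS]/(cp_mul c b) /cp_mul exchange_big /=.
apply: eq_bigr => y _; apply: eq_bigr => x _.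
rewrite (Comm_Atilde_coeff _ _ bC) (Comm_Atilde_coeff _ _ cC).
by rewrite (mulrC c@_y) alpha_sym abelG.
Qed.
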